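(* For any odd prime $p$ and any positive integer $r$, $$\frac1{p^r}\sum_{k=0}^{p^r-1}(3k+1)\frac{(\frac12)_k^3}{(1)_k^3}4^k\equiv\frac1{p}\sum_{k=0}^{p-1}(3k+1)\frac{(\frac12)_k^3}{(1)_k^3}4^k\pmod{p^4}.$$
   Context: $(x)_k=x(x+1)\cdots(x+k-1)$ is the Pochhammer symbol, with $(x)_0=1$. A congruence $a\equiv b\pmod{p^m}$ between rational numbers means that $(a-b)/p^m$ is a rational number whose denominator is not divisible by $p$. *)

(* Defs.v *)
From HB Require Import structures.
From mathcomp Require Import all_boot all_order all_algebra.
Set Implicit Arguments. Unset Strict Implicit. Unset Printing Implicit Defensive.
Import Order.TTheory GRing.Theory Num.Theory.
Local Open Scope ring_scope.

Definition poch (x : rat) (k : nat) : rat := \prod_(i < k) (x + i%:R).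

Definition p_integral (p : nat) (q : rat) : bool := ~~ (p %| `|denq q|)%N.

Definition ratcong (p m : nat) (a b : rat) : Prop :=
  p_integral p ((a - b) / (p%:R ^+ m)).

Definition S (n : nat) : rat :=
  \sum_(0 <= k < n)
     (3 * k%:R + 1) * (poch (1/2) k ^+ 3 / poch 1 k ^+ 3) * 4 ^+ k.

(* Main.v *)
(** Write [P n x = \prod_(1 <= i < n) (1 - x^2 / (2i)^2)].  A WZ pair turns the
    truncated sum into
      [S n = \sum_(0 < s <= n, s odd) s * C(2n, n + s) * P n s],
    so that [S n / n] is the sum of [tau n s = (s / n) * C(2n, n + s) * P n s].
    Let [n] be a positive power of the odd prime [p].  The number
    [(s / n) * C(2n, n + s)] is an integer, and [(s / n)^2 * P n s] is
    [p]-integral because [\prod_(i < n) (2 i + c) / n!] is.  Hence [p^4] divides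
    [tau (p n) s] when [p] does not divide [s], and [p^2] divides [tau n s] when
    [0 < s < n].  Finally [tau (p n) (p s)] is [tau n s] times products over
    indices prime to [p] which are visibly 1 modulo [p^2], and modulo [p^4] for
    [s = n]; comparing term by term, [S (p n) / (p n)] and [S n / n] agree
    modulo [p^4]. *)
Require Import Defs.
From mathcomp Require Import all_boot all_order all_algebra.
From mathcomp Require Import ring zify.
Set Implicit Arguments. Unset Strict Implicit. Unset Printing Implicit Defensive.
Import Order.TTheory GRing.Theory Num.Theory.
Local Open Scope ring_scope.

(** * Rationals integral at [p] and congruences between them *)

Lemma natr_neq0 (n : nat) : (0 < n)%N -> n%:R != 0 :> rat.
Proof. by rewrite pnatr_eq0 lt0n. Qed.

(** The reduced denominator is coprime to the numerator, so by Gauss it divides [d]. *)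
Lemma p_integral_frac (p : nat) (a : int) (d : nat) (q : rat) :
  prime p -> ~~ (p %| d)%N -> q * d%:R = a%:~R -> p_integral p q.
Proof.
move=> p_pr pNd eq_qd; apply: contra pNd => p_den.
apply: (dvdn_trans p_den).
have: numq q * d%:Z = a * denq q.
  apply: (@intr_inj rat); rewrite !rmorphM /= numqE -eq_qd.
  by rewrite mulrAC.
move/(congr1 absz); rewrite !abszM absz_nat => eq_nd.
rewrite -(@Gauss_dvdr _ `|numq q|); last by rewrite coprime_sym coprime_num_den.
by rewrite eq_nd dvdn_mull.
Qed.

Lemma p_integral_den (p : nat) (q : rat) : p_integral p q ->
  exists (a : int) (d : nat), ~~ (p %| d)%N /\ q * d%:R = a%:~R.
Proof.
move=> qp; exists (numq q), `|denq q|%N; split=> //.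
by rewrite numqE pmulrn absz_denq.
Qed.

Section PIntegers.
Variables (p : nat) (p_pr : prime p).
Local Notation pint := (p_integral p).

Lemma pint_int (a : int) : pint a%:~R.
Proof. by rewrite /p_integral denq_int dvdn1 neq_ltn prime_gt1 ?orbT. Qed.

Lemma pint_nat (n : nat) : pint n%:R.
Proof. by rewrite pmulrn pint_int. Qed.

Lemma pintM x y : pint x -> pint y -> pint (x * y).
Proof.
move=> /p_integral_den[a [c [pNc xE]]] /p_integral_den[b [d [pNd yE]]].
apply: (@p_integral_frac p (a * b) (c * d)) => //.
  by rewrite Euclid_dvdM // negb_or pNc.
by rewrite natrM rmorphM /= -xE -yE mulrACA.
Qed.

Lemma pintD x y : pint x -> pint y -> pint (x + y).
Proof.
move=> /p_integral_den[a [c [pNc xE]]] /p_integral_den[b [d [pNd yE]]].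
apply: (@p_integral_frac p (a * d%:Z + b * c%:Z) (c * d)) => //.
  by rewrite Euclid_dvdM // negb_or pNc.
by rewrite natrM rmorphD !rmorphM /= -xE -yE; ring.
Qed.

Lemma pintN x : pint x -> pint (- x).
Proof. by rewrite /p_integral denqN. Qed.

Lemma pintB x y : pint x -> pint y -> pint (x - y).
Proof. by move=> xp /pintN; apply: pintD. Qed.

Lemma pintX x k : pint x -> pint (x ^+ k).
Proof.
by move=> xp; elim: k => [|k IH]; rewrite ?expr0 ?(pint_nat 1) // exprS pintM.
Qed.

Lemma pintV (n : nat) : ~~ (p %| n)%N -> pint n%:R^-1.
Proof.
move=> pNn; apply: (@p_integral_frac p 1 n) => //.
by rewrite mulVf // natr_neq0 // lt0n; apply: contra pNn => /eqP->.
Qed.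

Lemma pint_prod (I : Type) (r : seq I) (P : pred I) (F : I -> rat) :
  (forall i, P i -> pint (F i)) -> pint (\prod_(i <- r | P i) F i).
Proof. by move=> Fp; elim/big_ind: _; [apply: (pint_nat 1) | apply: pintM |]. Qed.

Lemma pint_sum (I : eqType) (r : seq I) (P : pred I) (F : I -> rat) :
  (forall i, i \in r -> P i -> pint (F i)) -> pint (\sum_(i <- r | P i) F i).
Proof.
move=> Fp; rewrite big_seq_cond; elim/big_ind: _; [exact: (pint_nat 0) | exact: pintD |].
by move=> i /andP[]; apply: Fp.
Qed.

Lemma p_neq0 : p%:R != 0 :> rat.
Proof. exact/natr_neq0/prime_gt0. Qed.

Lemma ratcong_refl m a : ratcong p m a a.
Proof. by rewrite /ratcong subrr mul0r (pint_nat 0). Qed.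

Lemma ratcong_trans m a b c :
  ratcong p m a b -> ratcong p m b c -> ratcong p m a c.
Proof.
move=> ab bc; rewrite /ratcong (_ : a - c = (a - b) + (b - c)); last by ring.
by rewrite mulrDl pintD.
Qed.

Lemma ratcong_pint m a b : pint b -> ratcong p m a b -> pint a.
Proof.
move=> bp ab; rewrite (_ : a = (a - b) / p%:R ^+ m * p%:R ^+ m + b).
  by apply: pintD => //; apply: pintM => //; apply/pintX/pint_nat.
by field; rewrite expf_neq0 // p_neq0.
Qed.

Lemma ratcongM m a b c d : pint b -> pint d ->
  ratcong p m a b -> ratcong p m c d -> ratcong p m (a * c) (b * d).
Proof.
move=> bp dp ab cd; have cp := ratcong_pint dp cd.
rewrite /ratcong (_ : (_ - _) / _ =
  (a - b) / p%:R ^+ m * c + b * ((c - d) / p%:R ^+ m)).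
  by apply: pintD; apply: pintM.
by field; rewrite expf_neq0 // p_neq0.
Qed.

Lemma ratcong_prod m (r : seq nat) (P : pred nat) (F G : nat -> rat) :
  (forall i, P i -> pint (G i)) ->
  (forall i, P i -> ratcong p m (F i) (G i)) ->
  ratcong p m (\prod_(i <- r | P i) F i) (\prod_(i <- r | P i) G i).
Proof.
move=> Gp FG.
(* Multiplying congruences requires integral right-hand sides, so the induction carries integrality
   along. *)
suff [] : ratcong p m (\prod_(i <- r | P i) F i) (\prod_(i <- r | P i) G i)
  /\ pint (\prod_(i <- r | P i) G i) by [].
elim/big_ind2: _ => [|a b c d [ab bp] [cd dp]|i Pi].
- by split; [apply: ratcong_refl | apply: (pint_nat 1)].
- by split; [apply: ratcongM | apply: pintM].
- by split; [apply: FG | apply: Gp].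
Qed.

Lemma ratcong_mulr m a b c : pint c ->
  ratcong p m a b -> ratcong p m (c * a) (c * b).
Proof. by move=> cp ab; rewrite /ratcong -mulrBr -mulrA pintM. Qed.

End PIntegers.

(** * The two products and the WZ relation *)

Definition Pprod (n : nat) (x : rat) : rat :=
  \prod_(1 <= i < n) (1 - (x / (2 * i%:R)) ^+ 2).

(** In Pochhammer form this is [((1 + x)/2)_n ((1 - x)/2)_n / (1)_n^2]. *)
Definition Rprod (n : nat) (x : rat) : rat :=
  \prod_(0 <= i < n) (((2 * i%:R + 1) ^+ 2 - x ^+ 2) / (4 * (i%:R + 1) ^+ 2)).

Lemma PprodS n x : (0 < n)%N ->
  Pprod n.+1 x = Pprod n x * (1 - (x / (2 * n%:R)) ^+ 2).
Proof. by move=> n_gt0; rewrite /Pprod big_nat_recr. Qed.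

Lemma PprodN n x : Pprod n (- x) = Pprod n x.
Proof. by apply: eq_bigr => i _; rewrite mulNr sqrrN. Qed.

(** Since [(2i + 1)^2 - (x - 1)^2 = (2i + 2 - x)(2i + x)], the shifted factors regroup into
    [(2i - x)(2i + x)], leaving [x] at the bottom end and [2n - x] at the top. *)
Lemma Rprod_sub1 n x : (0 < n)%N ->
  4 * n%:R ^+ 2 * Rprod n (x - 1) = Pprod n x * ((2 * n%:R - x) * x).
Proof.
case: n => // n _; elim: n => [|n IH].
  rewrite /Rprod /Pprod big_nat1 big_geq //=. by field.
rewrite /Rprod big_nat_recr //= -/(Rprod _ _) PprodS //.
move: IH; set A := Rprod _ _; set B := Pprod _ _ => IH.
have n1 := natr_neq0 (ltn0Sn n).
have eA : A = B * ((2 * n.+1%:R - x) * x) / (4 * n.+1%:R ^+ 2).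
  by rewrite -IH; field; rewrite nat1r.
rewrite eA -[n.+2%:R]natr1.
by field; rewrite nat1r natr1 !natr_neq0.
Qed.

Lemma Rprod_add1 n x : (0 < n)%N ->
  4 * n%:R ^+ 2 * Rprod n (x + 1) = - (Pprod n x * ((2 * n%:R + x) * x)).
Proof.
move=> n_gt0.
have -> : Rprod n (x + 1) = Rprod n (- x - 1).
  by apply: eq_bigr => i _; congr ((_ - _) / _); ring.
by rewrite Rprod_sub1 // PprodN; ring.
Qed.

Lemma mul_bin_diagr (m k : nat) :
  k.+1%:R * 'C(m.+1, k.+1)%:R = m.+1%:R * 'C(m, k)%:R :> rat.
Proof. by rewrite -!natrM -mul_bin_diag. Qed.

Lemma mul_bin_downr (m k : nat) :
  (m.+1%:R - k%:R) * 'C(m.+1, k)%:R = m.+1%:R * 'C(m, k)%:R :> rat.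
Proof.
case: (leqP k m.+1) => [le_km | lt_mk].
  by rewrite -natrB // -!natrM -mul_bin_down.
by rewrite !bin_small ?mulr0 // ltnW.
Qed.

(** [hterm] and [phi] are, up to sign, the residues at [a = s - 1] and [a = e] of the WZ pair
    attached to the summand with [(1/2)_k^2 / (1)_k^2] deformed to
    [((1 + a)/2)_k ((1 - a)/2)_k / ((1 + a)_k (1 - a)_k)]. *)
Definition hterm (n s : nat) : rat := s%:R * 'C(n.*2, n + s)%:R * Pprod n s%:R.

Definition phi (n e : nat) : rat :=
  (3 * n%:R + 1) * 'C(n.*2, n + e)%:R * Rprod n e%:R.

(** The shift lemmas turn both [Rprod] values into multiples of [Pprod n s], and all the binomials
    are rational multiples of a single one; what remains is an identity of rational functions in [n]
    and [s]. *)
Lemma hterm_phi n s : (0 < n)%N -> (0 < s)%N ->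
  hterm n.+1 s - hterm n s = phi n s.-1 - phi n s.+1.
Proof.
case: s => // s n_gt0 _; rewrite /hterm /phi /=.
rewrite PprodS // doubleS.
have RA := Rprod_sub1 s.+1%:R n_gt0.
have RB := Rprod_add1 s.+1%:R n_gt0.
rewrite -[s.+1%:R]natr1 addrK in RA.
rewrite natr1 in RA.
rewrite natr1 in RB.
move: RA RB; set P := Pprod _ _; set R1 := Rprod _ _; set R2 := Rprod _ _ => RA RB.
have n0 := natr_neq0 n_gt0.
have {}RA : R1 = P * ((2 * n%:R - s.+1%:R) * s.+1%:R) / (4 * n%:R ^+ 2).
  by rewrite -RA; field.
have {}RB : R2 = - (P * ((2 * n%:R + s.+1%:R) * s.+1%:R)) / (4 * n%:R ^+ 2).
  by rewrite -RB; field.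
rewrite {}RA {}RB -[s.+1%:R]natr1.
rewrite !addSn !addnS.
have b1 := mul_bin_diagr n.*2.+1 (n + s).+1.
have b2 := mul_bin_downr n.*2 (n + s).+1.
have b3 := mul_bin_diagr n.*2 (n + s).
have b4 := mul_bin_downr n.*2.+1 (n + s).+2.
have b5 := mul_bin_downr n.*2 (n + s).+2.
have d1 := natr_neq0 (ltn0Sn n.*2).
have d2 := natr_neq0 (ltn0Sn n.*2.+1).
move: b1 b2 b3 b4 b5 d1 d2.
set Q := 'C(_.+2, _)%:R; set X := 'C(_.+1, _.+1)%:R; set Y := 'C(_.*2, _.+1)%:R.
set Y0 := 'C(_.*2, _)%:R; set Z := 'C(_.+1, _)%:R; set Y2 := 'C(_.*2, _.+2)%:R.
rewrite -!natr1 !natrD -mul2n natrM => b1 b2 b3 b4 b5 d1 d2.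
(* [Q] is the binomial of [hterm n.+1]; all others are now expressed through it. *)
have eX : X = (n%:R + s%:R + 1 + 1) * Q / (2 * n%:R + 1 + 1) by rewrite b1; field.
have eZ : Z = (2 * n%:R + 1 + 1 - (n%:R + s%:R + 1 + 1)) * Q / (2 * n%:R + 1 + 1).
  by rewrite b4; field.
have -> : Y = (2 * n%:R + 1 - (n%:R + s%:R + 1)) * X / (2 * n%:R + 1).
  by rewrite b2; field.
have -> : Y0 = (n%:R + s%:R + 1) * X / (2 * n%:R + 1) by rewrite b3; field.
have -> : Y2 = (2 * n%:R + 1 - (n%:R + s%:R + 1 + 1)) * Z / (2 * n%:R + 1).
  by rewrite b5; field.
by rewrite eX eZ; field; rewrite n0 d1 d2.
Qed.

(** * The truncated sum as a sum over odd [s] *)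

Lemma pochS x k : poch x k.+1 = poch x k * (x + k%:R).
Proof. by rewrite /poch big_ord_recr. Qed.

Lemma poch1_neq0 k : poch 1 k != 0.
Proof. by apply/prodf_neq0 => i _; rewrite nat1r natr_neq0. Qed.

Lemma central_bin_poch k :
  'C(k.*2, k)%:R = 4 ^+ k * (poch (1 / 2) k / poch 1 k) :> rat.
Proof.
elim: k => [|k IH]; first by rewrite /poch !big_ord0 bin0 expr0; field.
have b1 := mul_bin_diagr k.*2.+1 k.
have b2 := mul_bin_downr k.*2 k.
have e1 := natr_neq0 (ltn0Sn k).
have e2 : 'C(k.*2.+1, k)%:R = k.*2.+1%:R * 'C(k.*2, k)%:R / k.+1%:R :> rat.
  rewrite -b2 (_ : k.*2.+1%:R - k%:R = k.+1%:R); first by field; rewrite nat1r.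
  by rewrite -!natr1 -mul2n natrM; ring.
have e3 : 'C(k.+1.*2, k.+1)%:R = k.*2.+2%:R * 'C(k.*2.+1, k)%:R / k.+1%:R :> rat.
  by rewrite doubleS -b1; field; rewrite nat1r.
rewrite e3 e2 IH !pochS exprS -!natr1 -mul2n natrM.
by field; rewrite poch1_neq0 nat1r e1.
Qed.

Lemma Rprod0_poch k : Rprod k 0 = (poch (1 / 2) k / poch 1 k) ^+ 2.
Proof.
elim: k => [|k IH]; first by rewrite /Rprod /poch !big_ord0 big_geq //; field.
rewrite /Rprod big_nat_recr //= -/(Rprod _ _) IH !pochS.
by field; rewrite poch1_neq0 nat1r natr_neq0.
Qed.

(** Of the three Pochhammer quotients, one joins [4 ^+ k] to form the central binomial and the other
    two form [Rprod k 0]. *)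
Lemma S_phi n : S n = \sum_(0 <= k < n) phi k 0.
Proof.
apply: eq_bigr => k _; rewrite /phi addn0 Rprod0_poch central_bin_poch.
by field; rewrite poch1_neq0.
Qed.

Lemma telescope_odd (f : nat -> rat) W :
  \sum_(1 <= s < W.*2.+1 | odd s) (f s.-1 - f s.+1) = f 0%N - f W.*2.
Proof.
elim: W => [|W IH]; first by rewrite big_geq ?subrr.
rewrite doubleS big_mkcond big_nat_recr // big_nat_recr //= -big_mkcond IH odd_double /=.
by ring.
Qed.

Lemma hterm_small n s : (n < s)%N -> hterm n s = 0.
Proof. by move=> lt_ns; rewrite /hterm bin_small ?mulr0 ?mul0r //; lia. Qed.

(** Summing the WZ relation over odd [s] telescopes to [phi n 0]. Terms with [s > n] vanish, so [M]
    can be chosen later to match the ranges of two sums. *)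
Lemma S_hterm n M : odd M -> (0 < n < M)%N ->
  S n = \sum_(1 <= s < M | odd s) hterm n s.
Proof.
move=> M_odd; have -> : M = M./2.*2.+1 by lia.
move: M./2 => W {M M_odd}; rewrite S_phi.
case: n => // n /=; elim: n => [|n IH] lt_nW.
  (* The WZ relation needs a positive index, so the induction starts at [S 1], where only
     [hterm 1 1 = phi 0 0 = 1] survives. *)
  rewrite big_nat1 big_ltn_cond ?ltnS ?double_gt0; last by lia.
  rewrite /= big_nat_cond big1 => [|s /andP[/andP[s_gt1 _] _]].
    by rewrite /hterm /phi /Pprod /Rprod !big_geq.
  by rewrite hterm_small.
rewrite big_nat_recr //= IH; last by lia.
(* The far boundary term is zero: its lower binomial index exceeds the upper one. *)
have -> : phi n.+1 0 = phi n.+1 0 - phi n.+1 W.*2.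
  by rewrite [X in _ - X]/phi bin_small ?mulr0 ?mul0r ?subr0 //; lia.
rewrite -telescope_odd -big_split /=.
rewrite big_nat_cond [RHS]big_nat_cond; apply: eq_bigr => s /andP[/andP[s_gt0 _] _].
by rewrite -hterm_phi // addrC subrK.
Qed.

(** * Separating the indices divisible by [p] *)

(** Stated for any commutative operation because it serves both the products in [tau] and the sum
    over [s]. *)
Lemma big_multiples (R : Type) (idx : R) (op : Monoid.com_law idx)
    (p n : nat) (P : pred nat) (F : nat -> R) : (0 < p)%N ->
  \big[op/idx]_(1 <= i < p * n | P i) F i =
  op (\big[op/idx]_(1 <= i < n | P (p * i)%N) F (p * i)%N)
     (\big[op/idx]_(1 <= i < p * n | P i && ~~ (p %| i)%N) F i).
Proof.
move=> p_gt0; rewrite (bigID (fun i => (p %| i)%N)) /=; congr (op _ _).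
rewrite -(big_map (muln p) P F).
under eq_bigl do rewrite andbC.
rewrite -big_filter_cond; apply: perm_big; apply: uniq_perm.
- by rewrite filter_uniq // iota_uniq.
- rewrite map_inj_uniq ?iota_uniq // => i j /eqP.
  by rewrite eqn_pmul2l // => /eqP.
move=> i; rewrite mem_filter mem_index_iota; apply/andP/mapP.
  move=> [/dvdnP[j ->]]; rewrite muln_gt0 mulnC ltn_pmul2l // => /andP[/andP[j_gt0 _] lt_jn].
  by exists j; rewrite // mem_index_iota j_gt0.
move=> [j]; rewrite mem_index_iota => /andP[j_gt0 lt_jn] ->.
by rewrite dvdn_mulr // muln_gt0 p_gt0 j_gt0 ltn_pmul2l.
Qed.

Lemma Pprod_mul p n x : (0 < p)%N ->
  Pprod (p * n) (p%:R * x) = Pprod n x *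
    \prod_(1 <= i < p * n | ~~ (p %| i)%N) (1 - (p%:R * x / (2 * i%:R)) ^+ 2).
Proof.
move=> p_gt0; rewrite /Pprod big_multiples //=; congr (_ * _).
apply: eq_bigr => i _; rewrite natrM mulrCA -mulf_div divff ?mul1r //.
exact: natr_neq0.
Qed.

(** Pairing numerator and denominator at equal [j] leaves [m] and [k] over; the product then runs
    over [1 <= j < k], as [big_multiples] expects, and [m / k] is unchanged by scaling. *)
Lemma bin_prod m k : (0 < k)%N ->
  'C(m, k)%:R = m%:R / k%:R * \prod_(1 <= j < k) ((m%:R - j%:R) / j%:R) :> rat.
Proof.
case: k => // k _; elim: k => [|k IH]; first by rewrite big_geq // bin1; field.
have -> : 'C(m, k.+2)%:R = (m%:R - k.+1%:R) * 'C(m, k.+1)%:R / k.+2%:R :> rat.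
  apply: (canRL (mulfK (natr_neq0 _))) => //.
  rewrite mulrC -natrM mul_bin_left.
  have [le_km|lt_mk] := leqP k.+1 m; first by rewrite natrM natrB.
  by rewrite bin_small // muln0 mulr0.
rewrite IH [in RHS]big_nat_recr //=; set A := bigop _ _ _.
by field; rewrite nat1r -natrD !natr_neq0.
Qed.

Lemma bin_mul p m k : (0 < p)%N -> (0 < k)%N ->
  'C(p * m, p * k)%:R = 'C(m, k)%:R *
    \prod_(1 <= j < p * k | ~~ (p %| j)%N) (((p * m)%:R - j%:R) / j%:R) :> rat.
Proof.
move=> p_gt0 k_gt0; have p0 := natr_neq0 p_gt0.
rewrite !bin_prod ?muln_gt0 ?p_gt0 //.
rewrite (@big_multiples rat 1 *%R) //= mulrA; congr (_ * _ * _).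
  by rewrite !natrM -mulf_div divff ?mul1r.
apply: eq_bigr => i _.
by rewrite !natrM -mulrBr -mulf_div divff ?mul1r.
Qed.

(** The number of factors is [(p * k - 1) - (k - 1) = (p - 1) * k], which is even. *)
Lemma prod_opp1_coprime p k : odd p -> (0 < k)%N ->
  \prod_(1 <= j < p * k | ~~ (p %| j)%N) (-1) = 1 :> rat.
Proof.
move=> p_odd k_gt0; have p_gt0 : (0 < p)%N by case: p p_odd.
have := @big_multiples rat 1 (@GRing.mul rat) p k xpredT (fun=> -1) p_gt0.
rewrite !prodr_const_nat /= => eq_sgn.
apply: (@mulfI _ ((-1) ^+ (k - 1)) ); first by rewrite expf_neq0.
rewrite mulr1 -eq_sgn -[LHS]signr_odd -[RHS]signr_odd; congr (_ ^+ _).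
by rewrite !oddB ?muln_gt0 ?p_gt0 // oddM p_odd.
Qed.

(** * The terms of [S n / n] and tools for their integrality *)

Definition tau (n s : nat) : rat := hterm n s / n%:R.

Lemma half_mod (M : nat) (c : int) : odd M ->
  exists x : nat, exists t : int, 2 * x.+1%:Z - c = t * M%:Z.
Proof.
move=> M_odd; set N := `|c|%N.
have [m def_M] : exists m, M = m.*2.+1 by exists M./2; lia.
(* As [M = 2m + 1], [m + 1] inverts 2 modulo [M]; the added multiple of [M] makes the representative
   of [c / 2] positive. *)
have [x def_x] : exists x : nat,
    x.+1%:Z = c * m.+1%:Z + M%:Z * (N%:Z * m.+1%:Z + 1).
  exists (absz (c * m.+1%:Z + M%:Z * (N%:Z * m.+1%:Z + 1))).-1.
  nia.
exists x, (c + 2 * (N%:Z * m.+1%:Z + 1)); rewrite def_x def_M.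
have -> : m.*2.+1%:Z = 2 * m%:Z + 1 by lia.
have -> : m.+1%:Z = m%:Z + 1 by lia.
by ring.
Qed.

Lemma rising_even_prod n x :
  \prod_(0 <= i < n) (2 * (i%:R + x.+1%:R)) = 2 ^+ n * n`!%:R * 'C(x + n, n)%:R
  :> rat.
Proof.
elim: n => [|n IH]; first by rewrite big_geq // bin0 !mulr1.
have b := mul_bin_diagr (x + n) n.
rewrite big_nat_recr //= IH factS natrM exprS addnS.
transitivity (2 * 2 ^+ n * n`!%:R * (n.+1%:R * 'C((x + n).+1, n.+1)%:R) : rat).
  by rewrite b -[x.+1%:R]natr1 -[(x + n).+1%:R]natr1 natrD; ring.
by ring.
Qed.

Lemma tauE n s :
  tau n s = s%:R * 'C(n.*2, n + s)%:R / n%:R * Pprod n s%:R.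
Proof. by rewrite /tau /hterm mulrAC. Qed.

Lemma tau_diag n : (0 < n)%N -> tau n n = Pprod n n%:R.
Proof.
by move=> n_gt0; rewrite tauE addnn binn mulr1 divff ?mul1r // natr_neq0.
Qed.

Lemma S_tau n M : odd M -> (0 < n < M)%N ->
  n%:R^-1 * S n = \sum_(1 <= s < M | odd s) tau n s.
Proof.
by move=> M_odd n_lt; rewrite (S_hterm M_odd n_lt) mulrC mulr_suml.
Qed.

(** * Divisibility of the terms by powers of [p] *)

Section Dwork.
Variables (p : nat) (p_pr : prime p) (p_odd : odd p).
Local Notation pint := (p_integral p).
Let p_gt0 : (0 < p)%N := prime_gt0 p_pr.
Let p0 : p%:R != 0 :> rat := p_neq0 p_pr.

Lemma pint2V : pint 2^-1.
Proof.
by apply: (@pintV p p_pr 2); rewrite gtnNdvd // odd_prime_gt2.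
Qed.

(** A positive [s] below [p ^ k.+1] contains at most [k] factors [p]. *)
Lemma pint_pow_div k s : (0 < s < p ^ k.+1)%N -> pint (p%:R ^+ k / s%:R).
Proof.
elim: k s => [|k IH] s /andP[s_gt0 lt_s].
  by rewrite expr0 mul1r pintV // gtnNdvd // -[p]expn1.
have [/dvdnP[t def_s]|pNs] := boolP (p %| s)%N; last first.
  by apply: pintM => //; [apply/pintX/pint_nat | apply: pintV].
rewrite def_s mulnC natrM exprS -mulf_div divff // mul1r IH //.
move: lt_s s_gt0; rewrite def_s muln_gt0 expnS mulnC ltn_pmul2l // => ->.
by rewrite andbT => /andP[].
Qed.

Lemma pint_fact_part n : pint (p%:R ^+ logn p n`! / n`!%:R).
Proof.
have nf0 := fact_gt0 n.
rewrite -{2}(partnC p nf0) p_part natrM natrX.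
rewrite invfM mulrA divff ?mul1r ?expf_neq0 //.
apply: pintV => //; rewrite -prime_coprime //.
by rewrite (pnat_coprime (pnat_id p_pr)) // part_pnat.
Qed.

(** Modulo the [p]-part of [n!], [c] is twice a positive integer, which makes the
    product [2^n n!] times a binomial coefficient. *)
Lemma pint_odd_prod n (c : int) :
  pint (\prod_(0 <= i < n) (2 * i%:R + c%:~R) / n`!%:R).
Proof.
set e := logn p n`!.
have [x [t def_x]] := @half_mod (p ^ e) c ltac:(by rewrite oddX p_odd orbT).
set A := bigop _ _ _.
set B := \prod_(0 <= i < n) (2 * (i%:R + x.+1%:R)) : rat.
have AB : ratcong p e A B.
  apply: (ratcong_prod p_pr) => [i|i] _.
    by rewrite -natrD -natrM pint_nat.
  have -> : c%:~R = 2 * x.+1%:R - t%:~R * p%:R ^+ e :> rat.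
    rewrite -[c](subKr (2 * x.+1%:Z)) def_x rmorphB !rmorphM /=.
    by rewrite -!pmulrn natrX.
  rewrite /ratcong [X in p_integral _ X](_ : _ = (- t)%:~R) ?pint_int //.
  by rewrite rmorphN /=; field; rewrite expf_neq0.
have nf0 : n`!%:R != 0 :> rat by rewrite natr_neq0 // fact_gt0.
rewrite (_ : A / _ = (A - B) / p%:R ^+ e * (p%:R ^+ e / n`!%:R) + B / n`!%:R).
  apply: pintD => //; first by apply: pintM => //; apply: pint_fact_part.
  rewrite /B rising_even_prod mulrAC mulfK //.
  by rewrite -natrX -natrM pint_nat.
by field; rewrite nf0 expf_neq0.
Qed.

(** In [pint_odd_prod] the factor at [i = 0] is [c]; it is paired with the last factor [n] of the
    factorial. *)
Lemma pint_half_prod n (c : int) : (0 < n)%N ->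
  pint (c%:~R / n%:R * \prod_(1 <= i < n) ((2 * i%:R + c%:~R) / i%:R)).
Proof.
move=> n_gt0; have := pint_odd_prod n c.
rewrite big_ltn // mulr0 add0r fact_prod big_nat_recr //= natrM natr_prod.
by rewrite prodf_div [X in _ / X]mulrC mulf_div.
Qed.

(** Each factor splits as [(2i + s)(2i - s) / (4 i^2)], so [pint_half_prod] applies at [s] and at
    [- s], and 4 is invertible modulo the odd prime [p]. *)
Lemma pint_Pprod n s : (0 < n)%N -> pint ((s%:R / n%:R) ^+ 2 * Pprod n s%:R).
Proof.
move=> n_gt0.
have Xp := pint_half_prod s%:Z n_gt0.
have Xm := pint_half_prod (- s%:Z) n_gt0.
have pV : pint (\prod_(1 <= i < n) 2^-1 ^+ 2).
  by apply: pint_prod => // i _; apply/pintX/pint2V.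
have -> : Pprod n s%:R =
    \prod_(1 <= i < n) ((2 * i%:R + s%:R) / i%:R) *
    \prod_(1 <= i < n) ((2 * i%:R - s%:R) / i%:R) *
    \prod_(1 <= i < n) 2^-1 ^+ 2.
  rewrite -!big_split /=; apply: eq_big_nat => i /andP[i_gt0 _].
  by field; rewrite natr_neq0.
have := pintN (pintM p_pr (pintM p_pr Xp Xm) pV); congr (pint _).
rewrite rmorphN /= -pmulrn.
set A := bigop _ _ _; set B := bigop _ _ _; set C := bigop _ _ _.
by field; rewrite natr_neq0.
Qed.

(** A ballot number: it equals [C(2n - 1, n + s - 1) - C(2n - 1, n + s)]. *)
Lemma pint_bin_frac n s : (0 < n)%N -> pint (s%:R * 'C(n.*2, n + s)%:R / n%:R).
Proof.
case: n => // n _.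
have b1 := mul_bin_diagr n.*2.+1 (n + s).
have b2 := mul_bin_downr n.*2.+1 (n + s).+1.
rewrite doubleS addSn.
rewrite (_ : _ / _ = 'C(n.*2.+1, n + s)%:R - 'C(n.*2.+1, (n + s).+1)%:R).
  by apply: pintB; rewrite ?pint_nat.
have n0 := natr_neq0 (ltn0Sn n).
apply: (mulIf n0); rewrite divfK //.
apply: (@mulfI _ (2 : rat)) => //.
transitivity (n.*2.+2%:R * 'C(n.*2.+1, n + s)%:R
              - n.*2.+2%:R * 'C(n.*2.+1, (n + s).+1)%:R : rat).
  by rewrite -b1 -b2 -!natr1 -mul2n natrM natrD; ring.
by rewrite -!natr1 -mul2n natrM; ring.
Qed.

(* [(n / s)^2] is divisible by [p^4] here, and by [p^2] in [tau_lt]. *)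
Lemma tau_coprime k s : ~~ (p %| s)%N -> pint (tau (p ^ k.+2) s / p%:R ^+ 4).
Proof.
move=> pNs; set n := (p ^ k.+2)%N.
have n_gt0 : (0 < n)%N by rewrite expn_gt0 p_gt0.
have s0 : s%:R != 0 :> rat.
  by rewrite natr_neq0 // lt0n; apply: contra pNs => /eqP->.
have -> : tau n s / p%:R ^+ 4 =
    s%:R * 'C(n.*2, n + s)%:R / n%:R * ((s%:R / n%:R) ^+ 2 * Pprod n s%:R) *
    ((p%:R ^+ k) ^+ 2 * s%:R^-1 ^+ 2).
  rewrite tauE; set A := _ / n%:R; set P := Pprod _ _.
  by rewrite natrX !exprS; field; rewrite s0 p0 expf_neq0.
apply: pintM => //; last by apply: pintM => //; [do 2!apply: pintX => //; apply: pint_nat | apply/pintX/pintV].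
by apply: pintM => //; [apply: pint_bin_frac | apply: pint_Pprod].
Qed.

Lemma tau_lt k s : (0 < s < p ^ k.+1)%N -> pint (tau (p ^ k.+1) s / p%:R ^+ 2).
Proof.
move=> s_lt; set n := (p ^ k.+1)%N.
have n_gt0 : (0 < n)%N by rewrite expn_gt0 p_gt0.
have s0 : s%:R != 0 :> rat by rewrite natr_neq0 //; case/andP: s_lt.
have -> : tau n s / p%:R ^+ 2 =
    s%:R * 'C(n.*2, n + s)%:R / n%:R * ((s%:R / n%:R) ^+ 2 * Pprod n s%:R) *
    (p%:R ^+ k / s%:R) ^+ 2.
  rewrite tauE; set A := _ / n%:R; set P := Pprod _ _.
  by rewrite natrX !exprS; field; rewrite s0 p0 expf_neq0.
apply: pintM => //; last exact/pintX/pint_pow_div.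
by apply: pintM => //; [apply: pint_bin_frac | apply: pint_Pprod].
Qed.

Lemma pint_tau_diag k : pint (tau (p ^ k) (p ^ k)).
Proof.
rewrite tau_diag ?expn_gt0 ?p_gt0 //; case: k => [|k].
  by rewrite /Pprod big_geq // (pint_nat _ 1).
rewrite /Pprod big_nat; apply: pint_prod => // i i_lt.
apply: pintB; rewrite ?(pint_nat _ 1) //; apply: pintX => //.
rewrite natrX exprS invfM mulrACA; apply: pintM => //; last exact: pint_pow_div.
by apply: pintM => //; [apply: pint_nat | apply: pint2V].
Qed.

(** * Term-by-term comparison of consecutive powers of [p] *)

Lemma ratcong_Pfactor m n x : pint (x ^+ 2 / p%:R ^+ m) ->
  ratcong p m (\prod_(1 <= i < n | ~~ (p %| i)%N) (1 - (x / (2 * i%:R)) ^+ 2)) 1.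
Proof.
move=> xp.
have prod1 : 1 = \prod_(1 <= i < n | ~~ (p %| i)%N) 1 :> rat by rewrite big1.
rewrite [X in ratcong _ _ _ X]prod1.
apply: ratcong_prod => // i pNi; first exact: (pint_nat _ 1).
rewrite /ratcong [X in p_integral _ X](_ : _ = - (x ^+ 2 / p%:R ^+ m * (2^-1 * i%:R^-1) ^+ 2)).
  apply: pintN; apply: pintM => //; apply: pintX => //.
  by apply: pintM => //; [apply: pint2V | apply: pintV].
have i0 : i%:R != 0 :> rat.
  by rewrite natr_neq0 // lt0n; apply: contra pNi => /eqP->.
by field; rewrite i0 expf_neq0.
Qed.

(** Each factor is [-1] modulo [p^2], and the number of factors is even. *)
Lemma ratcong_bin_factor m k : (p %| m)%N -> (0 < k)%N ->
  ratcong p 2 (\prod_(1 <= j < p * k | ~~ (p %| j)%N) (((p * m)%:R - j%:R) / j%:R)) 1.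
Proof.
move=> /dvdnP[t ->] k_gt0.
rewrite -[X in ratcong _ _ _ X](@prod_opp1_coprime p k) //.
apply: ratcong_prod => // j pNj; first exact/pintN/(pint_nat _ 1).
rewrite /ratcong [X in p_integral _ X](_ : _ = t%:R * j%:R^-1).
  by apply: pintM => //; [apply: pint_nat | apply: pintV].
have j0 : j%:R != 0 :> rat.
  by rewrite natr_neq0 // lt0n; apply: contra pNj => /eqP->.
by rewrite !natrM; field; rewrite j0 p0.
Qed.

Lemma tau_mul n s : (0 < n)%N ->
  tau (p * n) (p * s) = tau n s *
    (\prod_(1 <= j < p * (n + s) | ~~ (p %| j)%N) (((p * n.*2)%:R - j%:R) / j%:R) *
     \prod_(1 <= i < p * n | ~~ (p %| i)%N) (1 - (p%:R * s%:R / (2 * i%:R)) ^+ 2)).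
Proof.
move=> n_gt0; rewrite !tauE natrM Pprod_mul // -mulnDr doubleMr.
rewrite bin_mul // ?addn_gt0 ?n_gt0 // natrM.
set A := bigop _ _ _; set B := bigop _ _ _; set P := Pprod _ _.
by field; rewrite p0 natr_neq0.
Qed.

(** For [s > n] both sides vanish; for [s < n] a factor [p^2] of [tau n s] is combined with a
    congruence modulo [p^2]; [s = n] is handled through [Pprod] alone. *)
Lemma tau_cong k s : (0 < s)%N ->
  ratcong p 4 (tau (p ^ k.+2) (p * s)) (tau (p ^ k.+1) s).
Proof.
move=> s_gt0; rewrite [(p ^ k.+2)%N]expnS; set n := (p ^ k.+1)%N.
have n_gt0 : (0 < n)%N by rewrite expn_gt0 p_gt0.
have p_n : (p %| n)%N by rewrite /n expnS dvdn_mulr.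
have [lt_sn | lt_ns | eq_sn] := ltngtP s n; last 2 first.
- rewrite /tau !hterm_small ?mul0r ?ltn_pmul2l //; exact: ratcong_refl.
(* On the diagonal the binomials are 1, and [x = p * n] is divisible by [p^2], so the remaining
   product is 1 modulo [p^4]. *)
- rewrite eq_sn tau_diag ?muln_gt0 ?p_gt0 // natrM Pprod_mul // -tau_diag //.
  rewrite -[X in ratcong _ _ _ X]mulr1.
  apply: ratcong_mulr => //; first exact: pint_tau_diag.
  apply: ratcong_Pfactor.
  rewrite [X in p_integral _ X](_ : _ = (p%:R ^+ k) ^+ 2); first by do 2!apply: pintX => //; apply: pint_nat.
  by rewrite /n natrX [_ ^+ k.+1]exprS; field.
rewrite tau_mul //; set U := bigop _ _ _; set V := bigop _ _ _.
have UV : ratcong p 2 (U * V) (1 * 1).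
  apply: ratcongM; rewrite ?(pint_nat _ 1) //.
    by apply: ratcong_bin_factor; rewrite ?addn_gt0 ?n_gt0 // -muln2 dvdn_mulr.
  apply: ratcong_Pfactor.
  rewrite [X in p_integral _ X](_ : _ = s%:R ^+ 2); first by apply/pintX/pint_nat.
  by field; rewrite p0.
(* The difference is [tau n s * (U * V - 1)], and each factor supplies [p^2]. *)
rewrite /ratcong [X in p_integral _ X](_ : _ = tau n s / p%:R ^+ 2 * ((U * V - 1 * 1) / p%:R ^+ 2)).
  by apply: pintM => //; apply: tau_lt; rewrite s_gt0.
by field; rewrite p0.
Qed.

Lemma S_step k :
  ratcong p 4 ((p ^ k.+2)%:R^-1 * S (p ^ k.+2)) ((p ^ k.+1)%:R^-1 * S (p ^ k.+1)).
Proof.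
set M := (p ^ k.+2)%N.
have M_odd : odd M by rewrite oddX p_odd orbT.
have M_gt0 : (0 < M)%N by rewrite expn_gt0 p_gt0.
have pM_odd : odd (p * M) by rewrite oddM p_odd.
have M_lt : (0 < M < p * M)%N by rewrite M_gt0 ltn_Pmull ?prime_gt1.
have n_lt : (0 < p ^ k.+1 < M)%N.
  by rewrite expn_gt0 p_gt0 ltn_exp2l ?prime_gt1 //= ltnSn.
rewrite (S_tau pM_odd M_lt) (S_tau M_odd n_lt).
(* The range [p * M] makes the multiples [p * s] run over exactly the [s < M] of the smaller sum,
   with the same parity since [p] is odd. The other terms are divisible by [p^4]. *)
rewrite (@big_multiples rat 0 +%R) //=.
under eq_bigl do rewrite oddM p_odd.
rewrite /ratcong addrAC -sumrB mulrDl !mulr_suml; apply: pintD => //.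
  apply: pint_sum => // s; rewrite mem_index_iota => /andP[s_gt0 _] _.
  exact: tau_cong.
by apply: pint_sum => // s _ /andP[_]; apply: tau_coprime.
Qed.

End Dwork.

Theorem theorem2p1 (p r : nat) :
  prime p -> odd p -> (0 < r)%N ->
  ratcong p 4 ((p%:R ^+ r)^-1 * S (p ^ r)) (p%:R^-1 * S p).
Proof.
move=> p_pr p_odd; case: r => // r _; rewrite -natrX.
elim: r => [|r IH]; first by rewrite expn1; apply: ratcong_refl.
by apply: ratcong_trans IH => //; apply: S_step.
Qed.
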